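(* In the extended-target model described in the context, let $Z$ be a finite set of distinct measurements with $p_{FA}(z)>0$ for all $z\in Z$, and let $g,h$ be test functions for which the standing assumptions of the context hold. Then $$\frac{\delta}{\delta Z}F[g,h]=F[g,h]\Big(\prod_{z'\in Z}p_{FA}(z')\Big)\sum_{\mathcal{P}\angle Z}\ \prod_{W\in\mathcal{P}}\bigg(\zeta_{FA}^{(|W|)}\big(p_{FA}[g]\big)+\sum_{\mathcal{Q}\angle W}\zeta_{k|k-1}^{(|\mathcal{Q}|)}\Big(p_{k|k-1}\big[h\,(1-p_D+p_D\,G_Z(p_z[g]))\big]\Big)\prod_{V\in\mathcal{Q}}\eta_V[g,h]\bigg),$$ where $$\eta_V[g,h]=p_{k|k-1}\Big[h\,p_D\,G_Z^{(|V|)}(p_z[g])\prod_{z'\in V}\frac{p_z(z')}{p_{FA}(z')}\Big].$$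
   Context: Set integrals: for a function $f$ of finite sets, $\int f(X)\,\delta X=\sum_{n\ge 0}\frac1{n!}\int f(\{x_1,\dots,x_n\})\,dx_1\cdots dx_n$; for a function $h$ and a finite set $X$, $h^X=\prod_{x\in X}h(x)$ (with $h^\emptyset=1$). For a density $p$ and a function $g$, $p[g]=\int g(y)p(y)\,dy$. Model. Targets have states $x$ in a state space; measurements $z$ lie in a measurement space. - Target-generated measurements: a detected target with state $x$ generates an i.i.d. cluster process with density $f(Z|x)=n!\,P_z(n|x)\prod_{z\in Z}p_z(z|x)$, $n=|Z|$, where $P_z(\cdot|x)$ is a probability distribution on $\{0,1,2,\dots\}$ with probability generating function $G_Z(y|x)=\sum_n P_z(n|x)y^n$, and $p_z(\cdot|x)$ is a probability density. A target with state $x$ is detected with probability $p_D(x)\in[0,1]$. - False alarms: an i.i.d. cluster process with density $f(Z)=n!\,P_{FA}(n)\prod_{z\in Z}p_{FA}(z)$, with cardinality generating function $G_{FA}(y)=\sum_n P_{FA}(n)y^n$. - Prior: an i.i.d. cluster process with density $f(X)=n!\,P_{k|k-1}(n)\prod_{x\in X}p_{k|k-1}(x)$, with cardinality generating function $G_{k|k-1}(y)=\sum_n P_{k|k-1}(n)y^n$ and probability density $p_{k|k-1}$. - Given the target set $X$, the measurement sets of the different targets and the false alarms are independent, and the observed measurement set is their union. Hence, with $G_{FA}[g]=\int g^Z f(Z)\,\delta Z$ and $G_Z[g|x]=\int g^Zf(Z|x)\,\delta Z$, the probability generating functional of the measurements is $$G[g|X]=G_{FA}[g]\prod_{x\in X}\big(1-p_D(x)+p_D(x)G_Z[g|x]\big).$$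 Define $F[g,h]=\int h^X\,G[g|X]\,f(X)\,\delta X$ with $f(X)$ the prior. Explicitly, $F[g,h]=G_{FA}(p_{FA}[g])\;G_{k|k-1}\big(p_{k|k-1}[h(1-p_D+p_DG_Z(p_z[g]))]\big)$. Notation. Arguments $x$ are omitted inside $p_{k|k-1}[\cdot]$: there $p_D$ means $p_D(x)$, $p_z(z')$ means $p_z(z'|x)$, $p_z[g]$ means $\int g(z)p_z(z|x)\,dz$, and $G_Z^{(i)}(p_z[g])$ means the $i$-th derivative of $y\mapsto G_Z(y|x)$ at $y=p_z[g]$; $p_{k|k-1}[\cdot]$ integrates over $x$ against $p_{k|k-1}$. A superscript $(i)$ denotes the $i$-th derivative. For $i\ge1$, $\zeta_{FA}^{(i)}=\big(G_{FA}^{(1)}/G_{FA}\big)^{(i-1)}=(\log G_{FA})^{(i)}$ and $\zeta_{k|k-1}^{(i)}=\big(G_{k|k-1}^{(1)}/G_{k|k-1}\big)^{(i-1)}=(\log G_{k|k-1})^{(i)}$. The notation $\mathcal{P}\angle Z$ means that $\mathcal{P}$ ranges over all partitions of the set $Z$ into nonempty subsets (for $Z=\emptyset$, only the empty partition, with empty product $1$). Functional derivative: for $Z=\{z_1,\dots,z_n\}$, $\frac{\delta}{\delta Z}F[g,h]=\frac{\partial^n}{\partial\varepsilon_1\cdots\partial\varepsilon_n}F[g+\sum_i\varepsilon_i\delta_{z_i},h]\big|_{\varepsilon=0}$, where $\delta_{z}$ is the Dirac delta, i.e. the linear expressions are replaced by $p_{FA}[g]+\sum_i\varepsilon_ip_{FA}(z_i)$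 and $p_z[g]+\sum_i\varepsilon_ip_z(z_i|x)$. Standing assumptions: $G_{FA}$ and $G_{k|k-1}$ are strictly positive at, and smooth in a neighbourhood of, the arguments at which they and their derivatives appear; and the function $\varepsilon\mapsto p_{k|k-1}\big[h(1-p_D+p_DG_Z(p_z[g]+\sum_i\varepsilon_ip_z(z_i)))\big]$ is smooth near $\varepsilon=0$ with its partial derivatives obtained by differentiating under the integral over $x$. *)

(* Defs.v *)
From HB Require Import structures.
From mathcomp Require Import all_boot all_order all_algebra finmap.
From mathcomp Require Import all_classical all_reals all_analysis.

Set Implicit Arguments.
Unset Strict Implicit.
Unset Printing Implicit Defensive.

Import Order.TTheory GRing.Theory Num.Theory.
Import numFieldNormedType.Exports.

Local Open Scope ring_scope.

Definition is_pmf (R : realType) (P : nat -> R) : Prop :=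
  (forall n, 0 <= P n) /\ (series P @ \oo --> (1 : R))%classic.

Definition is_density (R : realType) d (T : measurableType d)
    (mu : {measure set T -> \bar R}) (p : T -> R) : Prop :=
  [/\ measurable_fun setT p, forall x, 0 <= p x &
      (\int[mu]_x (p x)%:E = 1)%E].

(* The value is meaningful only where the power series converges. *)
Definition pgf (R : realType) (P : nat -> R) (y : R) : R := limn (pseries P y).

(* Functions of finite sets are represented by functions of sequences
   [:: x_1; ..; x_n]; those used here are invariant under permutation. *)
Definition iid_cluster (R : realType) (T : Type) (P : nat -> R) (p : T -> R)
    (s : seq T) : R :=
  (size s)`!%:R * P (size s) * \prod_(x <- s) p x.

(* n-fold iterated integral of f([:: x_1; ..; x_n]), where L stands for
   the one-variable integral phi |-> \int phi(x) dx, possibly weighted. *)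
Fixpoint iter_int (R : realType) (T : Type) (L : (T -> R) -> R) (n : nat)
    (f : seq T -> R) : R :=
  if n is m.+1 then L (fun x => iter_int L m (fun s => f (x :: s)))
  else f [::].

Definition set_int (R : realType) (T : Type) (L : (T -> R) -> R)
    (f : seq T -> R) : R :=
  limn (series (fun n => n`!%:R^-1 * iter_int L n f)).

Definition zeta (R : realType) (G : R -> R) (i : nat) : R -> R :=
  derive1n i.-1 (fun y => derive1 G y / G y).

Definition smooth_near1 (R : realType) (G : R -> R) (a : R) : Prop :=
  \forall y \near a, forall n, derivable (derive1n n G) y 1.

Definition iter_partial (R : realType) (n : nat) (s : seq 'I_n)
    (f : 'rV[R]_n -> R) : 'rV[R]_n -> R :=
  foldr (fun i u e => 'D_(delta_mx 0 i : 'rV[R]_n) u e) f s.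

Definition smooth_near (R : realType) (n : nat) (f : 'rV[R]_n -> R)
    (a : 'rV[R]_n) : Prop :=
  \forall e \near a, forall s, differentiable (iter_partial s f) e.

(* Near a, every iterated partial derivative of e |-> \int Phi x e dx is
   obtained by differentiating under the integral sign. *)
Definition diff_under_int (R : realType) d (T : measurableType d)
    (mu : {measure set T -> \bar R}) (n : nat) (Phi : T -> 'rV[R]_n -> R)
    (a : 'rV[R]_n) : Prop :=
  \forall e \near a, forall s : seq 'I_n,
    [/\ {ae mu, forall x, forall i : 'I_n,
           derivable (iter_partial s (Phi x)) e (delta_mx 0 i : 'rV[R]_n)},
        mu.-integrable setT (fun x => (iter_partial s (Phi x) e)%:E) &
        iter_partial s (fun e' => \int[mu]_x Phi x e') e
          = \int[mu]_x iter_partial s (Phi x) e].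

Record et_model (R : realType) d d'
    (X : measurableType d) (Y : measurableType d')
    (mu : {sigma_finite_measure set X -> \bar R})
    (nu : {sigma_finite_measure set Y -> \bar R}) := EtModel {
  pD : X -> R;
  Pz : X -> nat -> R;
  pz : X -> Y -> R;
  PFA : nat -> R;
  pFA : Y -> R;
  Pk : nat -> R;
  pk : X -> R;
  pD_meas : measurable_fun setT pD;
  pD_range : forall x, 0 <= pD x <= 1;
  Pz_meas : forall n, measurable_fun setT (fun x => Pz x n);
  Pz_pmf : forall x, is_pmf (Pz x);
  pz_meas : measurable_fun setT (fun xz : X * Y => pz xz.1 xz.2);
  pz_density : forall x, is_density nu (pz x);
  PFA_pmf : is_pmf PFA;
  pFA_density : is_density nu pFA;
  Pk_pmf : is_pmf Pk;
  pk_density : is_density mu pk }.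

Section Pgfl.
Context (R : realType) d d' (X : measurableType d) (Y : measurableType d').
Context (mu : {sigma_finite_measure set X -> \bar R}).
Context (nu : {sigma_finite_measure set Y -> \bar R}).
Variable M : et_model mu nu.

Definition GZ (x : X) : R -> R := pgf (Pz M x).
Definition GFA : R -> R := pgf (PFA M).
Definition Gk : R -> R := pgf (Pk M).

(* A generalized test function gamma on Y (a function plus Dirac deltas) is
   represented by the functional phi |-> \int phi(z) gamma(z) dz. *)
Definition testfun (g : Y -> R) (phi : Y -> R) : R := \int[nu]_z (phi z * g z).

(* g + sum_i eps_i delta_(z_i), where Z = {z_1, .., z_n}. *)
Definition testfun_dirac (g : Y -> R) (Z : {fset Y}) (eps : 'rV[R]_#|{: Z}|)
    (phi : Y -> R) : R :=
  testfun g phi + \sum_(i < #|{: Z}|) eps 0 i * phi (val (enum_val i)).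

(* G[gamma | X]; the weight gamma^Z of the set integrals over measurement
   sets is carried by the functional gamma. *)
Definition meas_pgfl (gamma : (Y -> R) -> R) (s : seq X) : R :=
  set_int gamma (iid_cluster (PFA M) (pFA M)) *
  \prod_(x <- s)
    (1 - pD M x + pD M x * set_int gamma (iid_cluster (Pz M x) (pz M x))).

Definition joint_pgfl_gen (gamma : (Y -> R) -> R) (h : X -> R) : R :=
  set_int (fun phi : X -> R => \int[mu]_x phi x)
    (fun s => (\prod_(x <- s) h x) * meas_pgfl gamma s
              * iid_cluster (Pk M) (pk M) s).

Definition joint_pgfl (g : Y -> R) (h : X -> R) : R :=
  joint_pgfl_gen (testfun g) h.

Definition func_deriv (Z : {fset Y}) (g : Y -> R) (h : X -> R) : R :=
  iter_partial (enum 'I_#|{: Z}|)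
    (fun eps => joint_pgfl_gen (testfun_dirac g eps) h) 0.

Definition pFA_of (g : Y -> R) : R := testfun g (pFA M).
Definition pz_of (g : Y -> R) (x : X) : R := testfun g (pz M x).
Definition pk_of (f : X -> R) : R := \int[mu]_x (f x * pk M x).

Definition etaV (Z : {fset Y}) (V : {set Z}) (g : Y -> R) (h : X -> R) : R :=
  pk_of (fun x => h x * pD M x * derive1n #|V| (GZ x) (pz_of g x)
    * \prod_(z in V) (pz M x (val z) / pFA M (val z))).

(* Integrand of p_{k|k-1}[h(1 - p_D + p_D G_Z(p_z[g] + sum_i eps_i p_z(z_i)))]
   with respect to dx, prior density included. *)
Definition perturbed_integrand (Z : {fset Y}) (g : Y -> R) (h : X -> R) (x : X)
    (eps : 'rV[R]_#|{: Z}|) : R :=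
  h x * (1 - pD M x + pD M x * GZ x (testfun_dirac g eps (pz M x))) * pk M x.

End Pgfl.

(* Main.v *)
Require Import Defs.
From HB Require Import structures.
From mathcomp Require Import all_boot all_order all_algebra finmap.
From mathcomp Require Import all_classical all_reals all_analysis.
From mathcomp Require Import ring.

Set Implicit Arguments.
Unset Strict Implicit.
Unset Printing Implicit Defensive.

Import Order.TTheory GRing.Theory Num.Theory.
Import numFieldNormedType.Exports.

Local Open Scope ring_scope.

(** The perturbed functional is F(eps) = G_FA(l(eps)) G_k(I(eps)) near eps = 0,
with l affine and I the perturbed integral. Its logarithmic partial derivative
in direction i is the block term of the singleton {i}, and differentiating the
block term of W in a direction i outside W gives the block term of i |: W. A
partition of i |: A arises from exactly one partition of A, either by adding the
block {i} or by putting i into an existing block; these two cases are the two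
halves of the Leibniz rule, so both the outer sum (over partitions of Z) and the
inner one (the chain rule for the derivatives of log G_k along I) follow by
induction from one differentiation lemma for sums over partitions. *)

(** * Sums over set partitions *)

(** Deleting the block [B] and adding it back are mutually inverse. Nonemptiness of [B] matters: it
    guarantees that [B] is not already a block of a partition of the complement. *)
Lemma sum_partition_block (T : finType) (R : nmodType) (D B : {set T})
    (Phi : {set {set T}} -> R) :
  B != finset.set0 -> B \subset D ->
  \sum_(P : {set {set T}} | finset.partition P D && (B \in P)) Phi P =
  \sum_(P : {set {set T}} | finset.partition P (D :\: B)%SET) Phi (B |: P)%SET.
Proof.
move=> B0 BD.
have notin P : finset.partition P (D :\: B)%SET -> B \notin P.
  move=> PDB; apply/negP => /(partitionS PDB); rewrite finset.subsetD.
  by rewrite -setI_eq0 finset.setIid (negbTE B0) andbF.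
rewrite (reindex_onto (fun P => B |: P)%SET (fun P => P :\ B)%SET) /=; last first.
  by move=> P /andP[_ BP]; rewrite finset.setD1K.
apply: eq_bigl => P; apply/idP/idP.
  move=> /andP[/andP[PD BP] /eqP <-]; exact: partitionD1.
move=> PDB; rewrite finset.setU11 finset.setU1K ?notin// eqxx !andbT.
rewrite -[D in finset.partition _ D](finset.setID D B) (finset.setIidPr BD).
apply: partitionU1 => //.
by rewrite -setI_eq0; apply/eqP/setP => x; rewrite !inE; case: (x \in B).
Qed.

(** Partitions are sorted by the block of [i], written [i |: W] with [W] inside [A]; the other
    blocks partition [A :\: W]. The case of empty [W] gives the new singleton, and for nonempty [W]
    restoring [W] as a block gives a partition of [A] with a marked block. *)
Lemma sum_partitionU1 (T : finType) (R : nmodType) (i : T) (A : {set T})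
    (Phi : {set {set T}} -> R) : i \notin A ->
  \sum_(P : {set {set T}} | finset.partition P (i |: A)%SET) Phi P =
  \sum_(P : {set {set T}} | finset.partition P A)
    (Phi ([set i] |: P)%SET +
     \sum_(W in P) Phi ((i |: W) |: (P :\ W))%SET).
Proof.
move=> iA.
have iW (W : {set T}) : W \subset A -> i \notin W.
  by move=> /fintype.subsetP WA; apply: contra iA => /WA.
transitivity (\sum_(W : {set T} | W \subset A)
    \sum_(P : {set {set T}} | finset.partition P (A :\: W)%SET)
      Phi ((i |: W) |: P)%SET).
  (* The inserted inner sum has exactly one term, the block of [P] that contains [i]; it is there to
     be exchanged with the sum over [P]. *)
  transitivity (\sum_(P : {set {set T}} | finset.partition P (i |: A)%SET)
     \sum_(B : {set T} | (i \in B) && (B \in P)) Phi P).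
    apply: eq_bigr => P Pp.
    have icov : i \in finset.cover P by rewrite (finset.cover_partition Pp) finset.setU11.
    rewrite (big_pred1 (finset.pblock P i)) // => B.
    apply/idP/eqP => [/andP[iB BP]|->]; last by rewrite finset.mem_pblock icov finset.pblock_mem.
    by rewrite (finset.def_pblock (partition_trivIset Pp) BP iB).
  rewrite (exchange_big_dep (fun B : {set T} => (i \in B) && (B \subset i |: A)%SET)) /=;
    last first.
    by move=> P B Pp /andP[-> BP]; rewrite (partitionS Pp BP).
  rewrite (reindex_onto (fun W => i |: W)%SET (fun B => B :\ i)%SET) /=; last first.
    by move=> B /andP[iB _]; rewrite finset.setD1K.
  apply: eq_big => [W|W].
    rewrite finset.setU11 /=; apply/idP/idP.
      move=> /andP[WA /eqP <-]; rewrite finset.subDset.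
      by apply: (fintype.subset_trans WA).
    by move=> WA; rewrite finset.setUS //= finset.setU1K ?eqxx // iW.
  move=> /andP[/andP[_ WA] /eqP WE].
  under eq_bigl => P do rewrite finset.setU11 /=.
  rewrite sum_partition_block//; last first.
    by apply/set0Pn; exists i; rewrite finset.setU11.
  apply: eq_bigl => P; congr finset.partition.
  apply/setP => x; rewrite !inE; case: (eqVneq x i) => //= ->.
  by rewrite (negbTE iA) andbF.
rewrite big_split /= (bigD1 finset.set0) ?finset.sub0set //=.
congr (_ + _).
  by apply: eq_big => [P|P _]; rewrite ?finset.setD0 ?finset.setU0.
rewrite (exchange_big_dep (fun W : {set T} => (W \subset A) && (W != finset.set0))) /=;
    last first.
  by move=> P W Pp WP; rewrite (partitionS Pp WP) (partition_neq0 Pp WP).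
apply: eq_bigr => W /andP[WA W0].
(* Used from right to left in spirit: a partition of [A] containing [W] is [W] together with a
   partition of [A :\: W]. *)
rewrite (sum_partition_block (fun P => Phi ((i |: W) |: (P :\ W))%SET)) //.
apply: eq_bigr => P Pp; rewrite finset.setU1K //.
apply/negP => /(partitionS Pp); rewrite finset.subsetD.
by rewrite -setI_eq0 finset.setIid (negbTE W0) andbF.
Qed.

(** * Directional derivatives of sums, products and compositions *)

Lemma is_derive_sumr (R : realType) (V : normedModType R) (I : Type)
    (r : seq I) (P : pred I) (F : I -> V -> R) (dF : I -> R) (x v : V) :
  (forall j, P j -> is_derive x v (F j) (dF j)) ->
  is_derive x v (fun y => \sum_(j <- r | P j) F j y) (\sum_(j <- r | P j) dF j).
Proof.
move=> FdF; elim: r => [|j r IH].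
  rewrite big_nil (_ : (fun _ => _) = cst 0); first exact: is_derive_cst.
  by apply/funext => y; rewrite big_nil.
rewrite big_cons; case: ifPn => Pj.
  rewrite (_ : (fun _ => _) = F j \+ (fun y => \sum_(j <- r | P j) F j y)).
    by apply: is_deriveD; exact: FdF.
  by apply/funext => y; rewrite big_cons Pj.
rewrite (_ : (fun _ => _) = (fun y => \sum_(j <- r | P j) F j y)) //.
by apply/funext => y; rewrite big_cons (negbTE Pj).
Qed.

Lemma is_derive_mul (R : realType) (V : normedModType R) (f g : V -> R)
    (df dg : R) (x v : V) :
  is_derive x v f df -> is_derive x v g dg ->
  is_derive x v (fun y => f y * g y) (f x * dg + df * g x).
Proof.
move=> fdf gdg; apply: (@is_derive_eq _ _ _ (f * g)).
by rewrite /GRing.scale /= [df * _]mulrC.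
Qed.

Lemma is_derive_prod_set (R : realType) (V : normedModType R) (I : finType)
    (A : {set I}) (F : I -> V -> R) (dF : I -> R) (x v : V) :
  (forall j, j \in A -> is_derive x v (F j) (dF j)) ->
  is_derive x v (fun y => \prod_(j in A) F j y)
    (\sum_(j in A) dF j * \prod_(k in A :\ j) F k x).
Proof.
have [n] := ubnP #|A|; elim: n A => // n IH A An FdF.
have [->|/set0Pn[j jA]] := eqVneq A finset.set0.
  rewrite big_set0 (_ : (fun _ => _) = cst 1); first exact: is_derive_cst.
  by apply/funext => y; rewrite big_set0.
have A'n : (#|A :\ j| < n)%N by move: An; rewrite (finset.cardsD1 j) jA.
have := IH _ A'n (fun k kA => FdF k (fintype.subsetP (finset.subD1set A j) k kA)).
move=> /(is_derive_mul (FdF j jA)).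
rewrite (_ : (fun _ => _) = (fun y => \prod_(j in A) F j y)); last first.
  by apply/funext => y; rewrite [RHS](finset.big_setD1 j).
move=> H; apply: is_derive_eq H _.
rewrite [RHS](finset.big_setD1 j)//= addrC; congr (_ + _).
rewrite mulr_sumr; apply: eq_bigr => k kA.
have kj : j \in A :\ k by move: kA; rewrite !inE jA andbT eq_sym => /andP[].
rewrite mulrCA [in RHS](finset.big_setD1 j)//=; do 2 congr (_ * _).
by apply: eq_bigl => l; rewrite !inE andbCA.
Qed.

Lemma is_derive_comp_real (R : realType) (V : normedModType R) (u : V -> R)
    (f : R -> R) (x v : V) :
  differentiable u x -> derivable f (u x) 1 ->
  is_derive x v (fun y => f (u y)) (derive1 f (u x) * 'D_v u x).
Proof.
move=> ud fd; have /derivable1_diffP fd' := fd.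
have cd : differentiable (f \o u) x by exact: differentiable_comp.
apply: DeriveDef; first exact: diff_derivable.
rewrite (deriveE _ cd) diff_comp //= deriv1E // (deriveE _ ud) /=.
by rewrite /GRing.scale /= mulrC.
Qed.

(** * Differentiation of sums over partitions *)

(** By the Leibniz rule, differentiating [z #|P|] creates the block of [i] alone, and
    differentiating a factor [a B] inserts [i] into [B]; [sum_partitionU1] says that these are all
    partitions of [i |: W]. The weight [z] depends on the number of blocks so that the lemma also
    covers the chain rule for an outer function. *)
Lemma is_derive_partition_sum (R : realType) (V : normedModType R) (T : finType)
    (z : nat -> V -> R) (a : {set T} -> V -> R) (i : T) (W : {set T}) (x v : V) :
  i \notin W ->
  (forall P, finset.partition P W ->
     is_derive x v (z #|P|) (z #|P|.+1 x * a [set i]%SET x)) ->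
  (forall B : {set T}, B \subset W -> B != finset.set0 ->
     is_derive x v (a B) (a (i |: B)%SET x)) ->
  is_derive x v
    (fun y => \sum_(P : {set {set T}} | finset.partition P W)
                z #|P| y * \prod_(B in P) a B y)
    (\sum_(P : {set {set T}} | finset.partition P (i |: W)%SET)
       z #|P| x * \prod_(B in P) a B x).
Proof.
move=> iW zd ad.
have step P : finset.partition P W -> is_derive x v
    (fun y => z #|P| y * \prod_(B in P) a B y)
    (z #|P| x * (\sum_(B in P) a (i |: B)%SET x * \prod_(C in P :\ B) a C x) +
     z #|P|.+1 x * a [set i]%SET x * \prod_(B in P) a B x).
  move=> PW; apply: (is_derive_mul (zd P PW)).
  apply: is_derive_prod_set => B BP.
  exact: ad (partitionS PW BP) (partition_neq0 PW BP).
apply: is_derive_eq (is_derive_sumr _ step) _.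
rewrite (sum_partitionU1 (fun P : {set {set T}} => z #|P| x * \prod_(B in P) a B x)) //.
apply: eq_bigr => P PW.
have iP (B : {set T}) : i \in B -> B \notin P.
  by move=> iB; apply: contra iW => /(partitionS PW)/fintype.subsetP; exact.
rewrite addrC; congr (_ + _); last first.
  by rewrite finset.cardsU1 iP ?inE//= finset.big_setU1 ?iP ?inE//= mulrA.
rewrite mulr_sumr; apply: eq_bigr => B BP.
have iBP : (i |: B)%SET \notin P :\ B by rewrite inE negb_and iP ?orbT// finset.setU11.
rewrite finset.cardsU1 iBP finset.big_setU1//=.
by rewrite [in LHS](finset.cardsD1 B P) BP.
Qed.

(** Induction on the list of directions. The hypotheses are imposed on an open set because each
    differentiation uses the previous identity in a neighbourhood. *)
Lemma iter_partial_partition_sum (R : realType) (n : nat) (T : finType)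
    (tau : 'I_n -> T) (U : set 'rV[R]_n) (F : 'rV[R]_n -> R)
    (a : {set T} -> 'rV[R]_n -> R) :
  injective tau -> open U ->
  (forall e i, U e -> is_derive e (delta_mx 0 i) F (F e * a [set tau i]%SET e)) ->
  (forall e i (W : {set T}), U e -> W != finset.set0 -> tau i \notin W ->
     is_derive e (delta_mx 0 i) (a W) (a (tau i |: W)%SET e)) ->
  forall s, uniq s -> forall e, U e -> iter_partial s F e = F e *
    \sum_(P : {set {set T}} | finset.partition P [set x in map tau s]%SET)
      \prod_(W in P) a W e.
Proof.
move=> tau_inj Uo Fd ad; elim=> [_ e Ue|i s IH /= /andP[is_ us] e Ue].
  rewrite /= (_ : [set x in [::]]%SET = finset.set0); last by apply/setP => x; rewrite !inE.
  under eq_bigl => P do rewrite partition_set0.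
  by rewrite big_pred1_eq big_set0 mulr1.
rewrite set_cons mulr_sumr.
apply: derive_val; apply: (@near_eq_is_derive _ _ _ (fun y =>
  \sum_(P : {set {set T}} | finset.partition P [set x in map tau s]%SET)
     F y * \prod_(W in P) a W y)).
  by near=> y; rewrite -mulr_sumr (IH us)//; near: y; exact: open_nbhs_nbhs.
(* The weight is [F] whatever the number of blocks, since the derivative of [F] is [F] times a
   singleton term. *)
apply: (@is_derive_partition_sum _ _ _ (fun=> F)) => [|P _|B BW B0]; last 2 first.
- exact: Fd.
- by apply: ad => //; apply: contra is_ => /(fintype.subsetP BW); rewrite inE mem_map.
by rewrite inE mem_map.
Unshelve. all: by end_near. Qed.

(** * Regularity of the logarithmic derivative near a point *)

(** The order [k] is kept finite so that closure under products and inverses can be proved by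
    induction on it, through [diffn_onS]. *)
Definition diffn_on (R : realType) (k : nat) (U : set R) (f : R -> R) : Prop :=
  forall n y, (n < k)%N -> U y -> derivable (derive1n n f) y 1.

Lemma diffn_onS (R : realType) (k : nat) (U : set R) (f : R -> R) :
  diffn_on k.+1 U f <->
  (forall y, U y -> derivable f y 1) /\ diffn_on k U (derive1 f).
Proof.
split=> [fk|[f1 fk] [|n] y nk Uy]; last 2 first.
- exact: f1.
- by rewrite derive1Sn; exact: fk.
split=> [y Uy|n y nk Uy]; first exact: (fk 0 y).
by rewrite -derive1Sn; exact: fk.
Qed.

Lemma diffn_on0 (R : realType) (U : set R) (f : R -> R) : diffn_on 0 U f.
Proof. by move=> n y; rewrite ltn0. Qed.

Lemma diffn_on_lt (R : realType) (k l : nat) (U : set R) (f : R -> R) :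
  (l <= k)%N -> diffn_on k U f -> diffn_on l U f.
Proof. by move=> lk fk n y nl; apply: fk; exact: leq_trans lk. Qed.

Lemma eq_diffn_on (R : realType) (k : nat) (U : set R) (f g : R -> R) :
  open U -> (forall y, U y -> f y = g y) -> diffn_on k U f -> diffn_on k U g.
Proof.
move=> Uo; elim: k f g => [|k IH] f g; first by move=> *; exact: diffn_on0.
move=> fg /diffn_onS[f1 fk].
have nfg y : U y -> \forall t \near y, f t = g t.
  by move=> Uy; near=> t; apply: fg; near: t; exact: open_nbhs_nbhs.
apply/diffn_onS; split => [y Uy|].
  exact: near_eq_derivable (nfg y Uy) (f1 y Uy).
apply: IH fk => y Uy; rewrite !derive1E; exact: near_eq_derive (nfg y Uy).
Unshelve. all: by end_near. Qed.

Lemma diffn_onD (R : realType) (k : nat) (U : set R) (f g : R -> R) :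
  open U -> diffn_on k U f -> diffn_on k U g ->
  diffn_on k U (fun y => f y + g y).
Proof.
move=> Uo; elim: k f g => [|k IH] f g; first by move=> *; exact: diffn_on0.
move=> /diffn_onS[f1 fk] /diffn_onS[g1 gk].
apply/diffn_onS; split => [y Uy|]; first exact: derivableD (f1 y Uy) (g1 y Uy).
apply: (eq_diffn_on Uo _ (IH _ _ fk gk)) => y Uy /=.
by rewrite !derive1E (deriveD (f1 y Uy) (g1 y Uy)).
Qed.

Lemma diffn_onM (R : realType) (k : nat) (U : set R) (f g : R -> R) :
  open U -> diffn_on k U f -> diffn_on k U g ->
  diffn_on k U (fun y => f y * g y).
Proof.
move=> Uo; elim: k f g => [|k IH] f g; first by move=> *; exact: diffn_on0.
move=> fS gS.
have [/diffn_onS[f1 fk] /diffn_onS[g1 gk]] := (fS, gS).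
have fk' := diffn_on_lt (leqnSn k) fS; have gk' := diffn_on_lt (leqnSn k) gS.
apply/diffn_onS; split => [y Uy|]; first exact: derivableM (f1 y Uy) (g1 y Uy).
apply: (eq_diffn_on Uo _ (diffn_onD Uo (IH _ _ fk' gk) (IH _ _ gk' fk))) => y Uy.
by rewrite !derive1E (deriveM (f1 y Uy) (g1 y Uy)).
Qed.

Lemma diffn_on_cst (R : realType) (k : nat) (U : set R) (c : R) :
  diffn_on k U (fun=> c).
Proof.
elim: k c => [|k IH] c; first exact: diffn_on0.
apply/diffn_onS; split => [y _|].
  exact: derivable_cst.
rewrite (_ : derive1 _ = fun=> 0); first exact: IH.
by apply/funext => y; rewrite derive1_cst.
Qed.

Lemma diffn_onV (R : realType) (k : nat) (U : set R) (f : R -> R) :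
  open U -> (forall y, U y -> f y != 0) -> diffn_on k U f ->
  diffn_on k U (fun y => (f y)^-1).
Proof.
move=> Uo f0; elim: k => [|k IH] fS; first exact: diffn_on0.
have /diffn_onS[f1 fk] := fS; have Vk := IH (diffn_on_lt (leqnSn k) fS).
apply/diffn_onS; split => [y Uy|]; first exact: derivableV (f0 y Uy) (f1 y Uy).
(* The derivative of the inverse is [-1] times the squared inverse times [derive1 f]; the induction
   hypothesis already gives the inverse order [k]. *)
have dV := diffn_onM Uo (@diffn_on_cst R k U (-1)) (diffn_onM Uo (diffn_onM Uo Vk Vk) fk).
apply: (eq_diffn_on Uo _ dV) => y Uy.
rewrite !derive1E (deriveV (f0 y Uy) (f1 y Uy)) /GRing.scale /=.
by rewrite mulN1r -invfM expr2 mulNr.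
Qed.

Lemma near_open (T : topologicalType) (a : T) (P : T -> Prop) :
  (\forall y \near a, P y) ->
  exists U : set T, [/\ open U, U a & forall y, U y -> P y].
Proof.
move=> aP; exists (interior [set y | P y]%classic).
by split; [exact: open_interior|exact: aP|exact: interior_subset].
Qed.

(** The pointwise conditions under which [G] can be divided by and every [zeta G m] with positive
    [m] can be differentiated. *)
Definition log_regular (R : realType) (G : R -> R) (y : R) : Prop :=
  [/\ 0 < G y, derivable G y 1 &
    forall m, derivable (derive1n m (fun t => derive1 G t / G t)) y 1].

Lemma log_regular_near (R : realType) (G : R -> R) (a : R) :
  0 < G a -> smooth_near1 G a ->
  \forall y \near a, log_regular G y.
Proof.
move=> Ga Gs.
have Gc : {for a, continuous G}.
  apply: differentiable_continuous; apply/derivable1_diffP.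
  exact: (nbhs_singleton Gs 0).
have Gpos : \forall y \near a, 0 < G y by exact: (cvgr_gt _ Gc).
have [U [Uo Ua UG]] := near_open (filterI Gs Gpos).
have Gk k : diffn_on k U G by move=> n y _ /UG[+ _]; exact.
have G0 y : U y -> G y != 0 by move=> /UG[_]; exact: lt0r_neq0.
(* The numerator loses one order, hence the appeal to order [k.+1] for [G]. *)
have Qk k : diffn_on k U (fun y => derive1 G y / G y).
  by apply: diffn_onM => //; [have /diffn_onS[] := Gk k.+1|exact: diffn_onV].
near=> y; have Uy : U y by near: y; exact: open_nbhs_nbhs.
split; [by have [] := UG y Uy|exact: (Gk 1 0)|move=> m; exact: (Qk m.+1)].
Unshelve. all: by end_near. Qed.

(** * Iterated partial derivatives of functions of an affine form *)

(* No convergence is assumed: the [lim] of a divergent family is [0]. This makes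
   [derive_comp_scale] and [iter_partial_affine_arg] unconditional as well. *)
Lemma lim_mull (R : realType) (T : Type) (F : set_system T) (f : T -> R) (c : R) :
  ProperFilter F ->
  lim (c * f t @[t --> F])%classic = c * lim (f t @[t --> F])%classic.
Proof.
move=> FF; have [->|c0] := eqVneq c 0.
  rewrite mul0r (_ : (fun _ => _) = fun=> 0); first exact: lim_cst.
  by apply/funext => t; rewrite mul0r.
have [fc|fd] := pselect (cvg (f t @[t --> F])%classic).
  by apply: cvg_lim => //; exact: cvgMr.
rewrite (dvgP fd) mulr0 dvgP // => cfc; apply: fd.
rewrite (_ : f = fun t => c^-1 * (c * f t)); first exact: is_cvgMr.
by apply/funext => t; rewrite mulKf.
Qed.

Lemma limn_series_mull (R : realType) (u : nat -> R) (c : R) :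
  limn (series (fun n => c * u n)) = c * limn (series u).
Proof.
rewrite -lim_mull (_ : series _ = fun n => c * series u n)//.
by apply/funext => n; rewrite /series /= mulr_sumr.
Qed.

(** For nonzero [b], the substitution of [t * b] for [t] preserves the filter of punctured
    neighbourhoods of [0], so both sides are limits along the same filter; for [b = 0] the quotient
    vanishes identically. *)
Lemma derive_comp_scale (R : realType) (G : R -> R) (b y : R) :
  lim (t^-1 * (G (t * b + y) - G y) @[t --> 0^'])%classic = b * derive1 G y.
Proof.
have [->|b0] := eqVneq b 0.
  rewrite mul0r (_ : (fun _ => _) = fun=> 0); first exact: lim_cst.
  by apply/funext => t; rewrite mulr0 add0r subrr mulr0.
have scale (c : R) : c != 0 -> ((t * c) @[t --> 0^'] --> 0^')%classic.
  move=> c0 A /= [e e0 eA]; exists (e / `|c|); first by rewrite /= divr_gt0// normr_gt0.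
  move=> t /=; rewrite sub0r normrN ltr_pdivlMr ?normr_gt0// => te t0.
  by apply: eA; rewrite /= ?sub0r ?normrN ?normrM// mulf_neq0.
rewrite /derive1 -lim_mull; congr lim.
pose q t := b * (t^-1 *: (G (t + y) - G y)).
rewrite -/q (_ : (fun _ => _) = q \o (fun t => t * b)); last first.
  apply/funext => t; rewrite /q /= /GRing.scale /= invfM mulrA.
  by rewrite [b * _]mulrCA divff// mulr1.
(* The two inclusions between the image filters come from scaling by [b^-1] and by [b]. *)
rewrite eqEsubset; split => [A qA|A qA] /=.
  have := scale b^-1; rewrite invr_eq0 => /(_ b0 _ qA).
  by rewrite /= nbhs_simpl /=; apply: filterS => t /=; rewrite mulfVK.
exact: (scale b b0 (q @^-1` A)%classic qA).
Qed.

(** Each differentiation in direction [i] pulls out one factor [b i] and raises the order of the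
    derivative of [G]. The list must be nonempty because the constant [A] disappears only after the
    first differentiation. *)
Lemma iter_partial_affine_arg (R : realType) (n : nat) (A B c : R)
    (b : 'I_n -> R) (G : R -> R) (s : seq 'I_n) : s != [::] ->
  iter_partial s (fun e : 'rV[R]_n => A + B * G (c + \sum_(j < n) e 0 j * b j)) =
  fun e => B * (\prod_(i <- s) b i) *
           derive1n (size s) G (c + \sum_(j < n) e 0 j * b j).
Proof.
have step (A' B' : R) (H : R -> R) i (e : 'rV[R]_n) :
  'D_(delta_mx 0 i : 'rV[R]_n) (fun e : 'rV[R]_n => A' + B' * H (c + \sum_(j < n) e 0 j * b j)) e
  = B' * b i * derive1 H (c + \sum_(j < n) e 0 j * b j).
  rewrite /derive (_ : (fun _ => _) = fun t : R => B' * (t^-1 *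
    (H (t * b i + (c + \sum_(j < n) e 0 j * b j)) -
     H (c + \sum_(j < n) e 0 j * b j)))).
    by rewrite lim_mull derive_comp_scale mulrA.
  (* A step [t] in direction [i] moves the affine argument by [t * b i], which is the quotient
     treated by [derive_comp_scale]. *)
  apply/funext => t.
  have lineE : c + \sum_(j < n) (t *: delta_mx 0 i + e) 0 j * b j =
      t * b i + (c + \sum_(j < n) e 0 j * b j).
    rewrite addrCA; congr (c + _).
    under eq_bigr do rewrite !mxE eqxx /= mulrDl.
    rewrite big_split /= (bigD1 i)//= eqxx mulr1 big1 ?addr0// => j ji.
    by rewrite (negbTE ji) mulr0 mul0r.
  by rewrite /= /shift lineE opprD addrACA subrr add0r -mulrBr [LHS]mulrCA.
elim: s => [//|i [|j s] IH] _; apply/funext => e.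
  by rewrite /= step big_seq1.
set f := (X in iter_partial _ X); rewrite -/f in IH.
rewrite -[LHS]/('D_(delta_mx 0 i : 'rV[R]_n) (iter_partial (j :: s) f) e) IH //.
rewrite (_ : (fun _ => _) = fun e : 'rV[R]_n => 0 + B * (\prod_(k <- j :: s) b k) *
  derive1n (size s).+1 G (c + \sum_(j < n) e 0 j * b j)); last first.
  by apply/funext => y; rewrite add0r.
by rewrite step [in RHS]big_cons -!mulrA; congr (_ * _); rewrite mulrCA.
Qed.

(** * Set integrals of product form *)

(** Homogeneity of [L] at [p] lets the variables be integrated one at a time. The induction
    generalizes [C], since fixing the first point [x] replaces [C m] by [C m.+1 * p x]. *)
Lemma set_int_prod (R : realType) (T : Type) (L : (T -> R) -> R) (p : T -> R)
    (C : nat -> R) :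
  (forall c, L (fun x => c * p x) = c * L p) ->
  set_int L (fun s => C (size s) * \prod_(x <- s) p x) =
  limn (series (fun n => n`!%:R^-1 * (C n * L p ^+ n))).
Proof.
move=> Lp; rewrite /set_int; congr (limn (series _)); apply/funext => n.
congr (_ * _); elim: n C => [|n IH] C /=; first by rewrite big_nil.
rewrite (_ : (fun x => _) = fun x => (C n.+1 * L p ^+ n) * p x).
  by rewrite Lp -mulrA -exprSr.
apply/funext => x; rewrite mulrAC -(IH (fun m => C m.+1 * p x)).
by congr iter_int; apply/funext => s; rewrite big_cons mulrA.
Qed.

(** The factorial in the cluster density cancels the one in the set integral, leaving the power
    series of [P] at [L p]. *)
Lemma set_int_iid_cluster (R : realType) (T : Type) (L : (T -> R) -> R)
    (P : nat -> R) (p : T -> R) :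
  (forall c, L (fun x => c * p x) = c * L p) ->
  set_int L (iid_cluster P p) = pgf P (L p).
Proof.
move=> Lp; rewrite (set_int_prod (fun n => n`!%:R * P n) Lp).
rewrite /pgf /pseries; congr (limn (series _)); apply/funext => n.
by rewrite -mulrA mulKf// pnatr_eq0 -lt0n fact_gt0.
Qed.

Lemma sum_partition1 (T : finType) (R : nmodType) (i : T)
    (Phi : {set {set T}} -> R) :
  \sum_(P : {set {set T}} | finset.partition P [set i]%SET) Phi P =
  Phi [set [set i]]%SET.
Proof.
rewrite -(finset.setU0 [set i]%SET) sum_partitionU1 ?inE//.
under eq_bigl => P do rewrite partition_set0.
by rewrite big_pred1_eq big_set0 addr0 !finset.setU0.
Qed.

Lemma eq_iter_partial (R : realType) (n : nat) (U : set 'rV[R]_n)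
    (f g : 'rV[R]_n -> R) (s : seq 'I_n) : open U ->
  (forall e, U e -> f e = g e) ->
  forall e, U e -> iter_partial s f e = iter_partial s g e.
Proof.
move=> Uo fg; elim: s => [//|i s IH] e Ue.
apply: near_eq_derive; near=> y; apply: IH; near: y.
exact: open_nbhs_nbhs.
Unshelve. all: by end_near. Qed.

(** Positivity of [m] is essential to the shift: because of the predecessor in [zeta], the orders
    [0] and [1] denote the same function. *)
Lemma is_derive_zeta_comp (R : realType) (V : normedModType R) (G : R -> R)
    (u : V -> R) (m : nat) (x v : V) :
  (0 < m)%N -> differentiable u x ->
  (forall k, derivable (derive1n k (fun y => derive1 G y / G y)) (u x) 1) ->
  is_derive x v (fun y => zeta G m (u y)) (zeta G m.+1 (u x) * 'D_v u x).
Proof. by case: m => // m _ ud Gd; exact: (is_derive_comp_real v ud (Gd m)). Qed.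

(** * The perturbed functional and its logarithmic derivatives *)

Section PgflDerivatives.
Context (R : realType) (d d' : measure_display).
Context (X : measurableType d) (Y : measurableType d').
Context (mu : {sigma_finite_measure set X -> \bar R}).
Context (nu : {sigma_finite_measure set Y -> \bar R}).
Variables (M : et_model mu nu) (Z : {fset Y}) (g : Y -> R) (h : X -> R).

(** The false alarms contribute a factor independent of the target set, and the rest is a product
    over targets; so the integrand is a function of the cardinality times a product of [phi], and
    [set_int_prod] applies. *)
Lemma joint_pgfl_genE (gamma : (Y -> R) -> R) :
  (forall c, gamma (fun z => c * pFA M z) = c * gamma (pFA M)) ->
  (forall x c, gamma (fun z => c * pz M x z) = c * gamma (pz M x)) ->
  mu.-integrable setT (fun x =>
    (h x * (1 - pD M x + pD M x * GZ M x (gamma (pz M x))) * pk M x)%:E) ->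
  joint_pgfl_gen M gamma h = GFA M (gamma (pFA M)) * Gk M
    (\int[mu]_x (h x * (1 - pD M x + pD M x * GZ M x (gamma (pz M x))) * pk M x)).
Proof.
move=> gFA gz phi_int; set phi := fun x => h x * _ * _ in phi_int *.
have phiZ c : \int[mu]_x (c * phi x) = c * \int[mu]_x phi x.
  by apply: RintegralZl.
rewrite /joint_pgfl_gen.
rewrite (_ : (fun s => _) = fun s =>
    ((size s)`!%:R * Pk M (size s) * GFA M (gamma (pFA M))) *
    \prod_(x <- s) phi x).
  rewrite (set_int_prod (fun n => n`!%:R * Pk M n * GFA M (gamma (pFA M))) phiZ).
  rewrite /Gk /pgf /pseries -limn_series_mull.
  congr (limn (series _)); apply/funext => n.
  by rewrite -!mulrA mulKf ?pnatr_eq0 -?lt0n ?fact_gt0// mulrCA.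
apply/funext => s; rewrite /meas_pgfl (set_int_iid_cluster _ gFA).
have -> : \prod_(x <- s)
      (1 - pD M x + pD M x * set_int gamma (iid_cluster (Pz M x) (pz M x))) =
    \prod_(x <- s) (1 - pD M x + pD M x * GZ M x (gamma (pz M x))).
  by apply: eq_bigr => x _; rewrite (set_int_iid_cluster _ (gz x)).
by rewrite /iid_cluster /phi !big_split /= /GFA; ring.
Qed.

Hypothesis pFAg_int : nu.-integrable setT (fun z => (pFA M z * g z)%:E).
Hypothesis pzg_int :
  forall x, nu.-integrable setT (fun z => (pz M x z * g z)%:E).

Lemma testfun_dirac0 : testfun_dirac nu g (0 : 'rV[R]_#|{: Z}|) = testfun nu g.
Proof.
apply/funext => phi; rewrite /testfun_dirac big1 ?addr0// => i _.
by rewrite mxE mul0r.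
Qed.

Lemma testfun_diracZ (e : 'rV[R]_#|{: Z}|) (p : Y -> R) (c : R) :
  nu.-integrable setT (fun z => (p z * g z)%:E) ->
  testfun_dirac nu g e (fun z => c * p z) = c * testfun_dirac nu g e p.
Proof.
move=> pg; rewrite /testfun_dirac mulrDr mulr_sumr; congr (_ + _).
  rewrite /testfun -RintegralZl//; congr Rintegral; apply/funext => z.
  by rewrite mulrA.
by apply: eq_bigr => i _; rewrite mulrCA.
Qed.

Let tau (i : 'I_#|{: Z}|) : Z := enum_val i.

(** For nonempty [V] this is the mixed partial derivative of [perturbed_integrand] in the directions
    [V]. For empty [V] it is not, as the missed-detection term is absent. *)
Definition partial_integrand (V : {set Z}) (e : 'rV[R]_#|{: Z}|) (x : X) : R :=
  h x * pD M x * pk M x * \prod_(z in V) pz M x (val z) *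
  derive1n #|V| (GZ M x) (testfun_dirac nu g e (pz M x)).

Lemma iter_partial_perturbed_integrand (s : seq 'I_#|{: Z}|) (x : X)
    (e : 'rV[R]_#|{: Z}|) : s != [::] -> uniq s ->
  iter_partial s (perturbed_integrand M g h x) e =
  partial_integrand [set z in map tau s]%SET e x.
Proof.
move=> s0 us.
have uts : uniq (map tau s) by rewrite map_inj_uniq//; exact: enum_val_inj.
(* The missed-detection term becomes the additive constant of [iter_partial_affine_arg]. Its formula
   then holds at every [x], so integrands can later be identified pointwise. *)
rewrite (_ : perturbed_integrand M g h x = fun e : 'rV[R]_#|{: Z}| =>
    h x * (1 - pD M x) * pk M x + h x * pD M x * pk M x *
    GZ M x (testfun nu g (pz M x) +
      \sum_(j < #|{: Z}|) e 0 j * pz M x (val (tau j)))); last first.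
  by apply/funext => y; rewrite /perturbed_integrand /testfun_dirac; ring.
rewrite iter_partial_affine_arg// /partial_integrand.
have -> : #|[set z in map tau s]%SET| = size s.
  by rewrite cardsE (card_uniqP uts) size_map.
congr (_ * _ * _).
under [RHS]eq_bigl => z do rewrite inE.
by rewrite -big_uniq//= big_map.
Qed.

Lemma exists_enumeration (V : {set Z}) :
  exists s, uniq s /\ V = [set z in map tau s]%SET.
Proof.
exists (map enum_rank (enum V)); split.
  by rewrite map_inj_uniq ?enum_uniq//; exact: enum_rank_inj.
rewrite -map_comp (eq_map (g := id)) ?map_id; last by move=> z; exact: enum_rankK.
by apply/setP => z; rewrite inE mem_enum.
Qed.

Lemma differentiable_testfun_dirac (phi : Y -> R) (e : 'rV[R]_#|{: Z}|) :
  differentiable (fun e : 'rV[R]_#|{: Z}| => testfun_dirac nu g e phi) e.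
Proof.
apply: differentiableD => //.
rewrite (_ : (fun _ => _) = \sum_(i < #|{: Z}|)
  (fun e : 'rV[R]_#|{: Z}| => e 0 i * phi (val (enum_val i)))); last first.
  by apply/funext => y; rewrite fct_sumE.
apply: differentiable_sum => i.
by apply: differentiableM => //; exact: differentiable_coord.
Qed.

Lemma derive_testfun_dirac (phi : Y -> R) (i : 'I_#|{: Z}|)
    (e : 'rV[R]_#|{: Z}|) :
  'D_(delta_mx 0 i) (fun e : 'rV[R]_#|{: Z}| => testfun_dirac nu g e phi) e =
  phi (val (tau i)).
Proof.
(* The affine formula is applied to the identity function and a single direction. *)
have := iter_partial_affine_arg 0 1 (testfun nu g phi)
  (fun j => phi (val (tau j))) id (isT : [:: i] != [::]).
move=> /(congr1 (@^~ e)) /=; rewrite big_seq1 mul1r derive1_id mulr1 => <-.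
rewrite [in RHS](_ : (fun _ => _) = fun y : 'rV[R]_#|{: Z}| =>
  testfun_dirac nu g y phi)//.
by apply/funext => y; rewrite add0r mul1r.
Qed.

Let I (e : 'rV[R]_#|{: Z}|) : R := \int[mu]_x perturbed_integrand M g h x e.
Let ell (e : 'rV[R]_#|{: Z}|) : R := testfun_dirac nu g e (pFA M).

Definition partial_integral (V : {set Z}) (e : 'rV[R]_#|{: Z}|) : R :=
  \int[mu]_x partial_integrand V e x.

(* The mixed partial derivative of log F in the directions W. *)
Definition block_term (W : {set Z}) (e : 'rV[R]_#|{: Z}|) : R :=
  zeta (GFA M) #|W| (ell e) * \prod_(z in W) pFA M (val z) +
  \sum_(Q : {set {set Z}} | finset.partition Q W)
    zeta (Gk M) #|Q| (I e) * \prod_(V in Q) partial_integral V e.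

Variable U : set 'rV[R]_#|{: Z}|.
Hypothesis U_open : open U.
Hypothesis I_smooth : forall e, U e -> forall s, differentiable (iter_partial s I) e.
Hypothesis I_diff_under : forall e, U e -> forall s,
  mu.-integrable setT
    (fun x => (iter_partial s (perturbed_integrand M g h x) e)%:E) /\
  iter_partial s I e =
    \int[mu]_x iter_partial s (perturbed_integrand M g h x) e.
Hypothesis GFA_regular : forall e, U e -> log_regular (GFA M) (ell e).
Hypothesis Gk_regular : forall e, U e -> log_regular (Gk M) (I e).

Lemma iter_partial_integral (s : seq 'I_#|{: Z}|) (e : 'rV[R]_#|{: Z}|) :
  U e -> s != [::] -> uniq s ->
  iter_partial s I e = partial_integral [set z in map tau s]%SET e.
Proof.
move=> Ue s0 us; have [_ ->] := I_diff_under Ue s.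
congr Rintegral; apply/funext => x.
exact: iter_partial_perturbed_integrand.
Qed.

Lemma integrable_partial_integrand (V : {set Z}) (e : 'rV[R]_#|{: Z}|) :
  U e -> V != finset.set0 ->
  mu.-integrable setT (fun x => (partial_integrand V e x)%:E).
Proof.
move=> Ue; have [s [us ->]] := exists_enumeration V => V0.
have s0 : s != [::].
  by apply: contraNneq V0 => ->; apply/eqP/setP => z; rewrite !inE.
have [+ _] := I_diff_under Ue s.
congr integrable; apply/funext => x.
by rewrite iter_partial_perturbed_integrand.
Qed.

Lemma derive_integral (i : 'I_#|{: Z}|) (e : 'rV[R]_#|{: Z}|) :
  U e -> 'D_(delta_mx 0 i) I e = partial_integral [set tau i]%SET e.
Proof.
move=> Ue; rewrite -[LHS]/(iter_partial [:: i] I e) iter_partial_integral//.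
by congr partial_integral; apply/setP => z; rewrite !inE.
Qed.

(** Near [e], [partial_integral V] is an iterated partial derivative of [I] along an enumeration of
    [V]. Smoothness of [I] then gives derivability, and one further direction extends the
    enumeration. *)
Lemma is_derive_partial_integral (V : {set Z}) (i : 'I_#|{: Z}|)
    (e : 'rV[R]_#|{: Z}|) :
  U e -> V != finset.set0 -> tau i \notin V ->
  is_derive e (delta_mx 0 i) (partial_integral V)
    (partial_integral (tau i |: V)%SET e).
Proof.
move=> Ue; have [s [us ->]] := exists_enumeration V => V0 iV.
have s0 : s != [::].
  by apply: contraNneq V0 => ->; apply/eqP/setP => z; rewrite !inE.
apply: (@near_eq_is_derive _ _ _ (iter_partial s I)).
  near=> y; apply: iter_partial_integral => //; near: y.
  exact: open_nbhs_nbhs.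
apply: DeriveDef; first exact: diff_derivable (I_smooth Ue s).
rewrite -[LHS]/(iter_partial (i :: s) I e) iter_partial_integral//=.
  by rewrite set_cons.
rewrite us andbT; apply: contra iV => is_; rewrite inE; exact: map_f.
Unshelve. all: by end_near. Qed.

(** In the false-alarm term [ell] is affine, so only the order of [zeta] rises and a factor [pFA]
    appears. The prior term is a partition sum with weights [zeta (Gk M) m (I y)], handled by
    [is_derive_partition_sum]. *)
Lemma is_derive_block_term (W : {set Z}) (i : 'I_#|{: Z}|)
    (e : 'rV[R]_#|{: Z}|) :
  U e -> W != finset.set0 -> tau i \notin W ->
  is_derive e (delta_mx 0 i) (block_term W) (block_term (tau i |: W)%SET e).
Proof.
move=> Ue W0 iW; apply: is_deriveD.
  have [_ _ zd] := GFA_regular Ue.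
  have W_gt0 : (0 < #|W|)%N by rewrite card_gt0.
  have := is_derive_mul
    (is_derive_zeta_comp (delta_mx 0 i) W_gt0
      (differentiable_testfun_dirac (pFA M) e) zd)
    (is_derive_cst (\prod_(z in W) pFA M (val z)) e (delta_mx 0 i)).
  move=> H; apply: is_derive_eq H _.
  by rewrite mulr0 add0r derive_testfun_dirac finset.cardsU1 iW finset.big_setU1//= mulrA.
apply: (is_derive_partition_sum (z := fun m y => zeta (Gk M) m (I y))) => //.
  move=> P PW; rewrite -derive_integral//.
  have [_ _ zd] := Gk_regular Ue.
  apply: is_derive_zeta_comp => //; last exact: (I_smooth Ue [::]).
  (* A partition of a nonempty set has at least one block, so the order of [zeta] is positive. *)
  rewrite card_gt0; apply: contra W0 => /eqP P0.
  by rewrite -(finset.cover_partition PW) P0 /finset.cover big_set0.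
move=> B BW B0; apply: is_derive_partial_integral => //.
exact: contra (fintype.subsetP BW _) iW.
Qed.

Lemma is_derive_pgfl (i : 'I_#|{: Z}|) (e : 'rV[R]_#|{: Z}|) :
  U e -> is_derive e (delta_mx 0 i) (fun y => GFA M (ell y) * Gk M (I y))
    (GFA M (ell e) * Gk M (I e) * block_term [set tau i]%SET e).
Proof.
move=> Ue; have [GFA0 GFAd _] := GFA_regular Ue.
have [Gk0 Gkd _] := Gk_regular Ue.
have := is_derive_mul
  (is_derive_comp_real (delta_mx 0 i) (differentiable_testfun_dirac _ e) GFAd)
  (is_derive_comp_real (delta_mx 0 i) (I_smooth Ue [::]) Gkd).
move=> H; apply: is_derive_eq H _.
rewrite derive_testfun_dirac derive_integral// /block_term.
rewrite sum_partition1 !cards1 !big_set1 /zeta /=.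
(* Positivity of both generating functions allows the factors [G] to be divided out, turning the
   derivatives into [zeta] of order [1]. *)
by field; rewrite !lt0r_neq0.
Qed.

Lemma iter_partial_pgfl (s : seq 'I_#|{: Z}|) (e : 'rV[R]_#|{: Z}|) :
  U e -> uniq s ->
  iter_partial s (fun y => joint_pgfl_gen M (testfun_dirac nu g y) h) e =
  joint_pgfl_gen M (testfun_dirac nu g e) h *
  \sum_(P : {set {set Z}} | finset.partition P [set z in map tau s]%SET)
    \prod_(W in P) block_term W e.
Proof.
move=> Ue us.
have FE y : U y -> joint_pgfl_gen M (testfun_dirac nu g y) h =
    GFA M (ell y) * Gk M (I y).
  move=> Uy; apply: joint_pgfl_genE => [c|x c|]; try exact: testfun_diracZ.
  by have [] := I_diff_under Uy [::].
rewrite (eq_iter_partial s U_open FE)// FE//.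
apply: (@iter_partial_partition_sum R _ _ tau U) => //.
- by move=> y i Uy; exact: is_derive_pgfl.
- by move=> y i W Uy W0 iW; exact: is_derive_block_term.
Qed.

(** Each [partial_integral V 0] is [etaV] times the product of [pFA] over [V]. Over the blocks of a
    partition of [W] these products recombine into the product over [W], which is common to all
    summands. *)
Lemma block_term_etaV (W : {set Z}) : U 0 ->
  (forall z, z \in Z -> 0 < pFA M z) ->
  block_term W 0 = (\prod_(z in W) pFA M (val z)) *
    (zeta (GFA M) #|W| (pFA_of M g) +
     \sum_(Q : {set {set Z}} | finset.partition Q W)
       zeta (Gk M) #|Q| (I 0) * \prod_(V in Q) etaV M V g h).
Proof.
move=> U0 pFA_gt0.
have integralE (V : {set Z}) : V != finset.set0 ->
    partial_integral V 0 = (\prod_(z in V) pFA M (val z)) * etaV M V g h.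
  move=> V0; have pV0 : \prod_(z in V) pFA M (val z) != 0.
    by apply/prodf_neq0 => z _; exact/lt0r_neq0/pFA_gt0/valP.
  rewrite /partial_integral /etaV /pk_of.
  rewrite (_ : (fun x => h x * _ * _ * _ * _) = fun x =>
      (\prod_(z in V) pFA M (val z))^-1 * partial_integrand V 0 x).
    by rewrite RintegralZl ?mulVKf//; exact: integrable_partial_integrand.
  apply/funext => x; rewrite /partial_integrand testfun_dirac0.
  by rewrite big_split /= prodfV /pz_of; ring.
rewrite /block_term /ell testfun_dirac0 mulrDr [_ * zeta _ _ _]mulrC.
congr (_ + _); rewrite mulr_sumr; apply: eq_bigr => Q QW.
rewrite mulrCA; congr (_ * _); rewrite (set_partition_big _ QW) -big_split /=.
apply: eq_bigr => V VQ; rewrite integralE//; exact: partition_neq0 QW VQ.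
Qed.

End PgflDerivatives.

(** * The functional derivative as the value at zero perturbation *)

Theorem mainTheorem1 (R : realType) (d d' : measure_display)
  (X : measurableType d) (Y : measurableType d')
  (mu : {sigma_finite_measure set X -> \bar R})
  (nu : {sigma_finite_measure set Y -> \bar R})
  (M : et_model mu nu) (Z : {fset Y}) (g : Y -> R) (h : X -> R)
  (pFA_gt0 : forall z, z \in Z -> 0 < pFA M z)
  (g_meas : measurable_fun setT g)
  (h_meas : measurable_fun setT h)
  (pFAg_int : nu.-integrable setT (fun z => (pFA M z * g z)%:E))
  (pzg_int : forall x, nu.-integrable setT (fun z => (pz M x z * g z)%:E))
  (GFA_gt0 : 0 < GFA M (pFA_of M g))
  (GFA_smooth : smooth_near1 (GFA M) (pFA_of M g))
  (Gk_gt0 : 0 < Gk M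
     (pk_of M (fun x => h x * (1 - pD M x + pD M x * GZ M x (pz_of M g x)))))
  (Gk_smooth : smooth_near1 (Gk M)
     (pk_of M (fun x => h x * (1 - pD M x + pD M x * GZ M x (pz_of M g x)))))
  (pk_smooth : smooth_near
     (fun eps : 'rV[R]_#|{: Z}| =>
        \int[mu]_x perturbed_integrand M g h x eps) 0)
  (pk_diff_under : diff_under_int mu
     (perturbed_integrand (Z := Z) M g h) 0) :
  func_deriv M Z g h =
    joint_pgfl M g h * (\prod_(z : Z) pFA M (val z)) *
    \sum_(P : {set {set Z}} | finset.partition P [set: Z]%SET)
      \prod_(W in P)
        (zeta (GFA M) #|W| (pFA_of M g) +
         \sum_(Q : {set {set Z}} | finset.partition Q W)
           zeta (Gk M) #|Q|
             (pk_of M (fun x => h x *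
                (1 - pD M x + pD M x * GZ M x (pz_of M g x)))) *
           \prod_(V in Q) etaV M V g h).
Proof.
set y0 := pk_of M _.
pose I (e : 'rV[R]_#|{: Z}|) := \int[mu]_x perturbed_integrand M g h x e.
pose ell (e : 'rV[R]_#|{: Z}|) := testfun_dirac nu g e (pFA M).
have I0 : I 0 = y0.
  congr Rintegral; apply/funext => x.
  by rewrite /perturbed_integrand testfun_dirac0.
have ell0 : ell 0 = pFA_of M g by rewrite /ell testfun_dirac0.
(* Regularity near the unperturbed argument is pulled back along the continuous map [ell]; the same
   is done for [I] below. *)
have near_ell : \forall e \near (0 : 'rV[R]_#|{: Z}|), log_regular (GFA M) (ell e).
  have := differentiable_continuous (differentiable_testfun_dirac nu g (pFA M)
    (0 : 'rV[R]_#|{: Z}|)).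
  by apply; rewrite -/(ell 0) ell0; exact: log_regular_near.
have near_I : \forall e \near (0 : 'rV[R]_#|{: Z}|), log_regular (Gk M) (I e).
  have := differentiable_continuous (nbhs_singleton pk_smooth [::]).
  by apply; rewrite /= -/(I 0) I0; exact: log_regular_near.
(* All local hypotheses are gathered on one open neighbourhood of [0], where the iterated
   derivatives are computed before evaluation at [0]. *)
have [U [U_open U0 UP]] := near_open
  (filterI (filterI pk_smooth pk_diff_under) (filterI near_ell near_I)).
have I_smooth e : U e -> forall s, differentiable (iter_partial s I) e.
  by move=> /UP[[]].
have I_diff e : U e -> forall s, mu.-integrable setT
      (fun x => (iter_partial s (perturbed_integrand M g h x) e)%:E) /\
    iter_partial s I e =
      \int[mu]_x iter_partial s (perturbed_integrand M g h x) e.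
  by move=> /UP[[_ H] _] s; have [] := H s.
rewrite /func_deriv (iter_partial_pgfl pFAg_int pzg_int U_open I_smooth I_diff
  _ _ U0 (enum_uniq _)); last 2 first.
- by move=> e /UP[_ []].
- by move=> e /UP[_ []].
rewrite testfun_dirac0 -mulrA; congr (_ * _); rewrite mulr_sumr.
rewrite (_ : [set z in map _ _]%SET = [set: Z]%SET); last first.
  apply/setP => z; rewrite !inE; apply/mapP; exists (enum_rank z).
    by rewrite mem_enum.
  by rewrite enum_rankK.
apply: eq_bigr => P Ppart.
have -> : \prod_(z : Z) pFA M (val z) =
    \prod_(z in [set: Z]%SET) pFA M (val z).
  by apply: eq_bigl => z; rewrite inE.
(* The product of [pFA] over [Z] is distributed over the blocks of [P], to match the factor that
   each [block_term] carries. *)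
rewrite (set_partition_big _ Ppart) -big_split /=.
apply: eq_bigr => W _.
by rewrite (block_term_etaV I_diff _ U0 pFA_gt0) -/(I 0) I0.
Qed.
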